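(* Let $N\ge1$ and $a,b,c,d,\theta_1,\theta_2\in(0,1)$. Suppose there are matrices $D^\uparrow,D^\rightarrow,E^\uparrow,E^\rightarrow$, a row vector $\langle W|$ and a column vector $|V\rangle$, of the same (possibly infinite) dimension, such that all admissible finite products of these matrices and vectors are well-defined (convergent in the infinite-dimensional case) and associative, satisfying $$D^\uparrow D^\rightarrow=D^\rightarrow D^\uparrow,\qquad E^\uparrow E^\rightarrow=E^\rightarrow E^\uparrow,$$ $$D^\uparrow E^\rightarrow=(1-\theta_2)D^\rightarrow E^\uparrow+\theta_1E^\rightarrow D^\uparrow,\qquad E^\uparrow D^\rightarrow=\theta_2D^\rightarrow E^\uparrow+(1-\theta_1)E^\rightarrow D^\uparrow,$$ $$\langle W|D^\rightarrow=(1-c)\langle W|D^\uparrow+a\langle W|E^\uparrow,\qquad \langle W|E^\rightarrow=(1-a)\langle W|E^\uparrow+c\langle W|D^\uparrow,$$ $$D^\uparrow|V\rangle=(1-b)D^\rightarrow|V\rangle+dE^\rightarrow|V\rangle,\qquad E^\uparrow|V\rangle=(1-d)E^\rightarrow|V\rangle+bD^\rightarrow|V\rangle.$$ Let $\mathcal P$ be a down-right path on the strip of width $N$ with outgoing edges $p_1,\dots,p_N\in\{\uparrow,\rightarrow\}$. Then the (unique) stationary measure of the six-vertex model on the strip with parameters $(a,b,c,d,\theta_1,\theta_2)$ on $\mathcal P$ is $$\mu_{\mathcal P}(\tau_1,\dots,\tau_N)=\frac{\langle W|\big((1-\tau_1)E^{p_1}+\tau_1D^{p_1}\big)\cdots\big((1-\tau_N)E^{p_N}+\tau_ND^{p_N}\big)|V\rangle}{\langle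 W|\prod_{i=1}^N(E^{p_i}+D^{p_i})|V\rangle},\qquad \tau\in\{0,1\}^N,$$ (with the product in the denominator ordered by increasing $i$ from left to right), assuming that the denominator is nonzero.
   Context: Strip and paths. Fix an integer $N\ge 1$. The strip of width $N$ is $\{(x,y)\in\mathbb Z^2: 0\le y\le x\le y+N\}$, with an edge between any two of its vertices at distance 1; each edge can carry at most one (up or right) arrow. Vertices $(y,y)$ are left boundary vertices, $(y+N,y)$ are right boundary vertices, all others are bulk vertices. The left/bottom edges at a vertex (those lying in the strip) are its incoming edges, the right/top ones its outgoing edges. Thus a left boundary vertex has at most a bottom incoming edge and a right outgoing edge; a right boundary vertex has a left incoming edge and a top outgoing edge. A down-right path $\mathcal P$ is a path in the strip from a left boundary vertex to a right boundary vertex with each step going down or right by 1 (so it has $N$ steps). Its outgoing edges are the edges going up or right from a vertex of $\mathcal P$ to a vertex not on $\mathcal P$; there are exactly $N$, labelled $p_1,\dots,p_N$ from up-left to down-right ($p_i$ is the unique one joining the lines $x-y=i-1$ and $x-y=i$); we write $p_i=\uparrow$ if this edge is vertical and $p_i=\rightarrow$ if it is horizontal. An outgoing configuration of $\mathcal P$ is $\tau=(\tau_1,\dots,\tau_N)\in\{0,1\}^N$, $\tau_i=1$ iff $p_i$ carries an arrow. Six-vertex dynamics. Let $\mathcal Q$ be a down-right path lying (weakly) above $\mathcal P$. Given an outgoing configuration of $\mathcal P$, sample sequentially the outgoing edges of all vertices between $\mathcal P$ and $\mathcal Q$, including those on $\mathcal Q$ and excluding those on $\mathcal P$, in order of increasing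 $y$ and, for equal $y$, increasing $x$, independently given the incoming edges, as follows. Bulk vertex: if both (resp. neither) incoming edges carry arrows, both (resp. neither) outgoing edges do; if only the left incoming edge carries an arrow, it exits to the right with probability $\theta_2$ and to the top with probability $1-\theta_2$; if only the bottom incoming edge carries an arrow, it exits to the top with probability $\theta_1$ and to the right with probability $1-\theta_1$. Left boundary vertex: if the bottom edge carries an arrow, the right edge carries one with probability $1-c$ (none with probability $c$); if the bottom edge is empty, the right edge carries an arrow with probability $a$ (none with probability $1-a$). Right boundary vertex: if the left edge carries an arrow, the top edge carries one with probability $1-b$ (none with probability $b$); if the left edge is empty, the top edge carries an arrow with probability $d$ (none with probability $1-d$). This defines a transition matrix $P_{\mathcal P,\mathcal Q}(\tau,\tau')$ from outgoing configurations of $\mathcal P$ to those of $\mathcal Q$. Particle system on $\mathcal P$. Let $\mathcal P_k=\mathcal P+(k,k)$. The interacting particle system of the six-vertex model on the strip on $\mathcal P$ is the time-homogeneous Markov chain on $\{0,1\}^N$ with transition matrix $P_{\mathcal P_k,\mathcal P_{k+1}}=P_{\mathcal P,\mathcal P_1}$. Its stationary measure is called the stationary measure of the six-vertex model on a strip on $\mathcal P$. For $a,b,c,d,\theta_1,\theta_2\in(0,1)$ this chain is irreducible, so the stationary measure is unique. *)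

(* Defs.v *)
From HB Require Import structures.
From mathcomp Require Import all_boot all_order all_algebra.
From mathcomp Require Import boolp classical_sets topology normedtype sequences.
Set Implicit Arguments.
Unset Strict Implicit.
Unset Printing Implicit Defensive.
Import Order.TTheory GRing.Theory Num.Theory.
Import numFieldNormedType.Exports.
Local Open Scope ring_scope.

Inductive dir := Up | Right.

Definition dir_bool (d : dir) : bool := if d is Up then true else false.
Definition bool_dir (b : bool) : dir := if b then Up else Right.
Lemma dir_boolK : cancel dir_bool bool_dir. Proof. by case. Qed.
HB.instance Definition _ := Equality.copy dir (can_type dir_boolK).

(* All vertices of the strip have nonnegative coordinates, so the strip is a
   subset of nat * nat. *)
Definition vertex := (nat * nat)%type.

Definition in_strip (N : nat) (v : vertex) : bool := (v.2 <= v.1 <= v.2 + N)%N.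
Definition left_boundary (v : vertex) : bool := v.1 == v.2.
Definition right_boundary (N : nat) (v : vertex) : bool := v.1 == (v.2 + N)%N.

(* An edge is encoded by its bottom or left endpoint and its direction. *)
Definition edge := (vertex * dir)%type.
Definition target (e : edge) : vertex :=
  if e.2 is Up then (e.1.1, e.1.2.+1) else (e.1.1.+1, e.1.2).

(* The predecessors are truncated at 0, but these functions are only used for
   vertices at which the edge in question lies in the strip. *)
Definition left_edge (v : vertex) : edge := ((v.1.-1, v.2), Right).
Definition bottom_edge (v : vertex) : edge := ((v.1, v.2.-1), Up).

Definition down_right_step (u v : vertex) : bool :=
  (v == (u.1.+1, u.2)) || (u == (v.1, v.2.+1)).

Definition down_right_path (N : nat) (P : seq vertex) : bool :=
  if P is v :: s then
    [&& all (in_strip N) P, path down_right_step v s,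
        left_boundary v & right_boundary N (last v s)]
  else false.

(* The edge going up (resp. right) from the vertex of P on the line x - y = k
   joins the lines k - 1 and k (resp. k and k + 1).  Hence, traversing P and
   listing Up before Right at each vertex, the outgoing edges come out in the
   order p_1, ..., p_N. *)
Definition outgoing_edges (N : nat) (P : seq vertex) : seq edge :=
  [seq e <- [seq (v, d) | v <- P, d <- [:: Up; Right]]
     | in_strip N (target e) & target e \notin P].

Definition out_edge (N : nat) (P : seq vertex) (i : nat) : edge :=
  nth ((0%N, 0%N), Up) (outgoing_edges N P) i.

Definition out_dir (N : nat) (P : seq vertex) (i : nat) : dir :=
  (out_edge N P i).2.

Definition shift (k : nat) (P : seq vertex) : seq vertex :=
  [seq (v.1 + k, v.2 + k)%N | v <- P].

(* A down-right path meets each line x - y = k exactly once; "above" and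
   "below" compare positions along these lines. *)
Definition weakly_above (P : seq vertex) (v : vertex) : bool :=
  has (fun u => (u.1 + v.2 == v.1 + u.2)%N && (u.2 <= v.2)%N) P.
Definition weakly_below (Q : seq vertex) (v : vertex) : bool :=
  has (fun u => (u.1 + v.2 == v.1 + u.2)%N && (v.2 <= u.2)%N) Q.

(* Listed by increasing y, and by increasing x for equal y. *)
Definition vertices_between (N : nat) (P Q : seq vertex) : seq vertex :=
  [seq v <- [seq (x, y) | y <- iota 0 (\max_(u <- Q) u.2).+1, x <- iota y N.+1]
     | [&& weakly_above P v, v \notin P & weakly_below Q v]].

(* Probability that the outgoing (top, right) edges of v are in state (t, r)
   given that its incoming (left, bottom) edges are in state (l, s).  Edges
   outside the strip never carry an arrow. *)
Definition vertex_prob (K : numFieldType) (N : nat) (a b c d th1 th2 : K)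
    (v : vertex) (l s t r : bool) : K :=
  if left_boundary v then
    if t then 0
    else if s then (if r then 1 - c else c) else (if r then a else 1 - a)
  else if right_boundary N v then
    if r then 0
    else if l then (if t then 1 - b else b) else (if t then d else 1 - d)
  else
    match l, s, t, r with
    | true, true, true, true => 1
    | false, false, false, false => 1
    | true, false, false, true => th2
    | true, false, true, false => 1 - th2
    | false, true, true, false => th1
    | false, true, false, true => 1 - th1
    | _, _, _, _ => 0
    end.

(* A state of the sampling procedure: which edges carry an arrow so far. *)
Definition arrows := edge -> bool.

Definition set_out (v : vertex) (t r : bool) (s : arrows) : arrows :=
  fun e => if e == (v, Up) then t else if e == (v, Right) then r else s e.

(* Expected value of F at the final state of the sequential sampling of the
   outgoing edges of the vertices in vs, starting from state s. *)
Fixpoint sample_expect (K : numFieldType) (N : nat) (a b c d th1 th2 : K)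
    (vs : seq vertex) (F : arrows -> K) (s : arrows) : K :=
  if vs is v :: vs' then
    \sum_(o : bool * bool)
       vertex_prob N a b c d th1 th2 v (s (left_edge v)) (s (bottom_edge v))
         o.1 o.2
       * sample_expect N a b c d th1 th2 vs' F (set_out v o.1 o.2 s)
  else F s.

Definition config (N : nat) := (N.-tuple bool)%type.

Definition arrows_of_config (N : nat) (P : seq vertex) (tau : config N)
    : arrows :=
  fun e => nth false tau (index e (outgoing_edges N P)).

Definition config_of_arrows (N : nat) (Q : seq vertex) (s : arrows)
    : config N :=
  [tuple s (out_edge N Q i) | i < N].

Definition transition (K : numFieldType) (N : nat) (a b c d th1 th2 : K)
    (P Q : seq vertex) (tau tau' : config N) : K :=
  sample_expect N a b c d th1 th2 (vertices_between N P Q)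
    (fun s => (config_of_arrows N Q s == tau')%:R) (arrows_of_config P tau).

Definition particle_system (K : numFieldType) (N : nat) (a b c d th1 th2 : K)
    (P : seq vertex) : config N -> config N -> K :=
  transition a b c d th1 th2 P (shift 1 P).

Definition stationary_measure (K : numFieldType) (S : finType)
    (T : S -> S -> K) (mu : S -> K) : Prop :=
  [/\ forall x, 0 <= mu x,
      \sum_x mu x = 1
    & forall y, \sum_x mu x * T x y = mu y].

(* dim = Some n : dimension n;  dim = None : rows and columns indexed by nat *)
Definition idx (dim : option nat) : Type :=
  if dim is Some n then 'I_n else nat.

Definition idx_summable (K : numFieldType) (dim : option nat)
    : (idx dim -> K) -> Prop :=
  match dim with
  | Some n => fun _ => True
  | None => fun f => cvgn (series f)
  end.

Definition idx_sum (K : numFieldType) (dim : option nat)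
    : (idx dim -> K) -> K :=
  match dim with
  | Some n => fun f => \sum_(i < n) f i
  | None => fun f => limn (series f)
  end.

Inductive shape := One | Full.

Definition shape_idx (dim : option nat) (s : shape) : Type :=
  if s is Full then idx dim else unit.

Definition gmx (K : numFieldType) (dim : option nat) (s t : shape) : Type :=
  shape_idx dim s -> shape_idx dim t -> K.

Definition gmul_defined (K : numFieldType) (dim : option nat) (s t : shape)
    (A : gmx K dim s Full) (B : gmx K dim Full t) : Prop :=
  forall i j, idx_summable (fun k : idx dim => A i k * B k j).

(* Only meaningful when gmul_defined A B holds. *)
Definition gmul (K : numFieldType) (dim : option nat) (s t : shape)
    (A : gmx K dim s Full) (B : gmx K dim Full t) : gmx K dim s t :=
  fun i j => idx_sum (fun k : idx dim => A i k * B k j).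

Notation "A ** B" := (gmul A B) (at level 40, left associativity).

(* Parenthesized admissible products of the letters <W|, |V>, D^p, E^p: the
   typing forces <W| to be leftmost and |V> to be rightmost. *)
Inductive letter := LW | LV | LD of dir | LE of dir.

Definition letter_src (l : letter) : shape := if l is LW then One else Full.
Definition letter_tgt (l : letter) : shape := if l is LV then One else Full.

Inductive prod_expr : shape -> shape -> Type :=
  | Leaf (l : letter) : prod_expr (letter_src l) (letter_tgt l)
  | Prod (s t : shape) : prod_expr s Full -> prod_expr Full t -> prod_expr s t.

Fixpoint expr_word (s t : shape) (e : prod_expr s t) : seq letter :=
  match e with
  | Leaf l => [:: l]
  | Prod _ _ e1 e2 => expr_word e1 ++ expr_word e2
  end.

Definition letter_val (K : numFieldType) (dim : option nat)
    (D E : dir -> gmx K dim Full Full)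
    (W : gmx K dim One Full) (V : gmx K dim Full One) (l : letter)
    : gmx K dim (letter_src l) (letter_tgt l) :=
  match l with
  | LW => W
  | LV => V
  | LD p => D p
  | LE p => E p
  end.
Arguments letter_val {K dim} D E W V l.

Fixpoint expr_val (K : numFieldType) (dim : option nat)
    (D E : dir -> gmx K dim Full Full)
    (W : gmx K dim One Full) (V : gmx K dim Full One)
    (s t : shape) (e : prod_expr s t) : gmx K dim s t :=
  match e with
  | Leaf l => letter_val D E W V l
  | Prod _ _ e1 e2 => expr_val D E W V e1 ** expr_val D E W V e2
  end.

Fixpoint expr_defined (K : numFieldType) (dim : option nat)
    (D E : dir -> gmx K dim Full Full)
    (W : gmx K dim One Full) (V : gmx K dim Full One)
    (s t : shape) (e : prod_expr s t) : Prop :=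
  match e with
  | Leaf _ => True
  | Prod _ _ e1 e2 =>
      [/\ expr_defined D E W V e1, expr_defined D E W V e2
        & gmul_defined (expr_val D E W V e1) (expr_val D E W V e2)]
  end.

Definition products_well_defined (K : numFieldType) (dim : option nat)
    (D E : dir -> gmx K dim Full Full)
    (W : gmx K dim One Full) (V : gmx K dim Full One) : Prop :=
  forall (s t : shape) (e : prod_expr s t), expr_defined D E W V e.

Definition products_associative (K : numFieldType) (dim : option nat)
    (D E : dir -> gmx K dim Full Full)
    (W : gmx K dim One Full) (V : gmx K dim Full One) : Prop :=
  forall (s t : shape) (e e' : prod_expr s t), expr_word e = expr_word e' ->
  forall i j, expr_val D E W V e i j = expr_val D E W V e' i j.

(* <W| M_1 ... M_n |V>, multiplied out from left to right *)
Definition sandwich (K : numFieldType) (dim : option nat)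
    (W : gmx K dim One Full) (Ms : seq (gmx K dim Full Full))
    (V : gmx K dim Full One) : K :=
  (foldl (fun A M => A ** M) W Ms ** V) tt tt.

Definition mpa_numerator (K : numFieldType) (N : nat) (dim : option nat)
    (D E : dir -> gmx K dim Full Full)
    (W : gmx K dim One Full) (V : gmx K dim Full One)
    (p : nat -> dir) (tau : config N) : K :=
  sandwich W
    [seq (fun k l => (1 - (tnth tau i)%:R) * E (p i) k l
                     + (tnth tau i)%:R * D (p i) k l) | i : 'I_N] V.

Definition mpa_denominator (K : numFieldType) (N : nat) (dim : option nat)
    (D E : dir -> gmx K dim Full Full)
    (W : gmx K dim One Full) (V : gmx K dim Full One) (p : nat -> dir) : K :=
  sandwich W [seq (fun k l => E (p i) k l + D (p i) k l) | i : 'I_N] V.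

(* Main.v *)
From mathcomp Require Import boolp classical_sets topology normedtype sequences.
Require Import Defs.
From mathcomp Require Import all_boot all_order all_algebra.
From mathcomp Require Import zify ring.
Import Order.TTheory GRing.Theory Num.Theory.
Import numFieldNormedType.Exports.
Local Open Scope ring_scope.
Set Implicit Arguments.
Unset Strict Implicit.
Unset Printing Implicit Defensive.

(** Sampling the vertices one at a time moves a frontier, a down-right path,
    from P to its translate.  Give every configuration on a frontier the
    weight <W| X_1 ... X_N |V>, where the letter X_i is D or E according to the
    presence of an arrow on the i-th outgoing edge, with the direction of that
    edge as exponent.  Passing a bulk vertex turns two consecutive directions
    (right, up) into (up, right); passing a boundary vertex turns the first
    direction from up to right or the last one from right to up.  The
    relations between the matrices say precisely that a product of the letters
    of the outgoing edges is the sum, weighted by the vertex probabilities, of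
    the products of the letters of the incoming edges.  Hence the weights on
    one frontier are transported to the weights on the next ([wt_step],
    [wt_run]).  As P and its translate have the same directions, the weights
    on P form an invariant vector of the chain, and expanding the product of
    the E + D gives their total ([sandwich_sum]).

    The geometric part reads a path as the function h giving its ordinate on
    each line x - y = k.  Passing the vertex on line k raises h k by one, and
    the prescribed sampling order never raises a line before its neighbours
    allow it ([line_before_admissible]).  This reduces the sampling of edge
    states to a process [run] on configurations ([sample_expect_run]).

    The weights are only known to be elements of the field, so positivity and
    uniqueness come from the chain itself.  Moving every isolated arrow to the
    right, and out of the strip at the right boundary, has positive probability
    and strictly lowers a potential on nonempty configurations, so the empty
    configuration is reached from everywhere at one common time.  By Doeblin's
    contraction argument an invariant vector is then determined by its total
    ([invariant_vector_unique]); since the absolute value of an invariant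
    vector is again invariant, the normalized weights are nonnegative
    ([invariant_vector_stationary]). *)

(** * Finite Markov chains over a numeric field *)

Definition stochastic (K : numFieldType) (S : finType) (T : S -> S -> K) :=
  (forall x y, 0 <= T x y) /\ (forall x, \sum_y T x y = 1).

Definition invariant_vector (K : numFieldType) (S : finType) (T : S -> S -> K)
  (nu : S -> K) := forall y, \sum_x nu x * T x y = nu y.

Fixpoint chain_iter (K : numFieldType) (S : finType) (T : S -> S -> K)
    (n : nat) (x y : S) : K :=
  if n is n'.+1 then \sum_z T x z * chain_iter T n' z y else (x == y)%:R.

Section Markov.
Variables (K : numFieldType) (S : finType).
Implicit Types (T : S -> S -> K) (nu : S -> K) (o : S).

Lemma sum_indicator (x : S) : \sum_y (x == y)%:R = 1 :> K.
Proof.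
rewrite (bigD1 x) //= eqxx big1 ?addr0 // => y.
by rewrite eq_sym => /negPf ->.
Qed.

Lemma stochastic_iter T n : stochastic T -> stochastic (chain_iter T n).
Proof.
move=> [T0 T1]; elim: n => [|n [I0 I1]]; split=> [x y|x] /=.
- exact: ler0n.
- exact: sum_indicator.
- by apply: sumr_ge0 => z _; rewrite mulr_ge0.
- rewrite exchange_big /= -[RHS](T1 x); apply: eq_bigr => z _.
  by rewrite -mulr_sumr I1 mulr1.
Qed.

Lemma invariant_iter T n nu :
  invariant_vector T nu -> invariant_vector (chain_iter T n) nu.
Proof.
move=> hT; elim: n => [|n IHn] y /=.
  rewrite (bigD1 y) //= eqxx mulr1 big1 ?addr0 // => x /negPf ->.
  by rewrite mulr0.
under eq_bigr do rewrite mulr_sumr.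
rewrite exchange_big /= -[RHS]IHn; apply: eq_bigr => z _.
under eq_bigr do rewrite mulrA.
by rewrite -mulr_suml hT.
Qed.

(** Lowering column o of T by e leaves a nonnegative kernel with row sums
    1 - e.  It still fixes nu, because the entries of nu add up to 0; so the
    l1 norm s of nu satisfies s <= (1 - e) * s. *)
Lemma doeblin_contraction T o nu :
  stochastic T -> (forall x, 0 < T x o) -> invariant_vector T nu ->
  \sum_x nu x = 0 -> forall x, nu x = 0.
Proof.
move=> [T0 T1] To hnu nu0.
have Tle1 x y : T x y <= 1.
  by rewrite -(T1 x) (bigD1 y) //= lerDl sumr_ge0.
(* The entries lie in [0, 1], so their product is a positive lower bound. *)
pose e := \prod_x T x o.
have e_gt0 : 0 < e by apply: prodr_gt0.
have e_le x : e <= T x o.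
  rewrite /e (bigD1 x) //= ler_piMr ?T0 //.
  by apply: prodr_ile1 => y _; rewrite T0 Tle1.
pose s := \sum_x `|nu x|.
have s_le : s <= (1 - e) * s.
  pose T' x y := T x y - e * (y == o)%:R.
  have T'0 x y : 0 <= T' x y.
    rewrite /T'; case: eqP => [->|_]; first by rewrite mulr1 subr_ge0.
    by rewrite mulr0 subr0.
  have T'1 x : \sum_y T' x y = 1 - e.
    rewrite sumrB T1 -mulr_sumr; congr (1 - _).
    by under eq_bigr do rewrite eq_sym; rewrite sum_indicator mulr1.
  have hnu' y : \sum_x nu x * T' x y = nu y.
    under eq_bigr do rewrite mulrBr.
    by rewrite sumrB hnu -mulr_suml nu0 mul0r subr0.
  rewrite /s mulr_sumr.
  under [leRHS]eq_bigr => x _ do rewrite -(T'1 x) mulr_suml.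
  rewrite exchange_big /=; apply: ler_sum => y _; rewrite -{1}hnu'.
  apply: le_trans (ler_norm_sum _ _ _) _; apply: ler_sum => x _.
  by rewrite normrM mulrC (ger0_norm (T'0 _ _)).
have s0 : s = 0.
  have s_ge0 : 0 <= s by apply: sumr_ge0.
  apply/eqP; rewrite eq_le s_ge0 andbT -(pmulr_rle0 _ e_gt0).
  by move: s_le; rewrite mulrBl mul1r lerBrDr gerDl.
move=> x; apply/eqP; rewrite -normr_eq0 eq_le normr_ge0 andbT -s0.
by rewrite /s (bigD1 x) //= lerDl sumr_ge0.
Qed.

(** The loop at o lets a trajectory wait there, so that all starting points
    share the time n. *)
Lemma chain_iter_gt0 T o (pot : S -> nat) :
  stochastic T ->
  (forall x, exists2 y, 0 < T x y & (pot y < pot x)%N \/ x = o /\ y = o) ->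
  forall n x, (pot x <= n)%N -> 0 < chain_iter T n x o.
Proof.
move=> hT hpot; elim=> [|n IHn] x le_x /=; have [y Txy hy] := hpot x.
  case: hy => [lt_yx|[-> _]]; last by rewrite eqxx ltr01.
  by move: (leq_trans lt_yx le_x).
have [I0 _] := stochastic_iter n hT.
have Iyo : 0 < chain_iter T n y o.
  case: hy => [lt_yx|[xo yo]].
    by apply: IHn; rewrite -ltnS; apply: leq_trans lt_yx le_x.
  move: Txy; rewrite xo yo => Too.
  elim: (n) => [|m IHm] /=; first by rewrite eqxx ltr01.
  rewrite (bigD1 o) //= ltr_pwDl ?mulr_gt0 // sumr_ge0 // => z _.
  by rewrite mulr_ge0 ?hT.1 ?(stochastic_iter m hT).1.
rewrite (bigD1 y) //= ltr_pwDl ?mulr_gt0 // sumr_ge0 // => z _.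
by rewrite mulr_ge0 ?hT.1.
Qed.

(** Doeblin's condition holds for a power of T whose exponent bounds the
    potential, and the difference of mu and nu is invariant of total 0. *)
Lemma invariant_vector_unique T o (pot : S -> nat) mu nu :
  stochastic T ->
  (forall x, exists2 y, 0 < T x y & (pot y < pot x)%N \/ x = o /\ y = o) ->
  invariant_vector T mu -> invariant_vector T nu ->
  \sum_x mu x = \sum_x nu x -> mu =1 nu.
Proof.
move=> hT hpot hmu hnu hsum x; apply/eqP; rewrite -subr_eq0; apply/eqP.
pose n := (\max_y pot y)%N.
apply: (@doeblin_contraction (chain_iter T n) o (fun x => mu x - nu x)).
- exact: stochastic_iter.
- move=> y; apply: (chain_iter_gt0 hT hpot); exact: leq_bigmax.
- apply: invariant_iter => y; rewrite -[in RHS]hmu -[in RHS]hnu -sumrB.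
  by apply: eq_bigr => z _; rewrite mulrBl.
- by rewrite sumrB hsum subrr.
Qed.

(** Only the sign of mu needs an argument.  By the triangle inequality |mu| is
    entrywise at most its image under T, and both have the same total, so |mu|
    is invariant.  Its total is at least |1| > 0; after normalization it agrees
    with mu by uniqueness, whence mu is nonnegative. *)
Lemma invariant_vector_stationary T o (pot : S -> nat) mu :
  stochastic T ->
  (forall x, exists2 y, 0 < T x y & (pot y < pot x)%N \/ x = o /\ y = o) ->
  invariant_vector T mu -> \sum_x mu x = 1 ->
  stationary_measure T mu /\
  forall nu, stationary_measure T nu -> forall x, nu x = mu x.
Proof.
move=> hT hpot hmu mu1; split; last first.
  move=> nu [_ nu1 hnu]; apply: (invariant_vector_unique hT hpot hnu hmu).
  by rewrite nu1 mu1.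
split=> //.
pose m x := `|mu x|; pose s := \sum_x m x.
have m_ge y : m y <= \sum_x m x * T x y.
  rewrite /m -{1}hmu; apply: le_trans (ler_norm_sum _ _ _) _.
  by apply: ler_sum => x _; rewrite normrM (ger0_norm (hT.1 _ _)).
have hm : invariant_vector T m.
  have sum0 : \sum_y ((\sum_x m x * T x y) - m y) = 0.
    rewrite sumrB exchange_big /=; apply/eqP; rewrite subr_eq0; apply/eqP.
    by apply: eq_bigr => x _; rewrite -mulr_sumr hT.2 mulr1.
  move=> y; apply/eqP; rewrite -subr_eq0; apply/eqP.
  move/eqP: sum0; rewrite psumr_eq0 => [/allP/(_ y)|z _]; last by rewrite subr_ge0.
  by rewrite mem_index_enum => /(_ isT)/eqP.
have s_gt0 : 0 < s.
  apply: lt_le_trans (ltr01) _; rewrite -[leLHS]normr1 -mu1.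
  exact: ler_norm_sum.
move=> x; rewrite (@invariant_vector_unique T o pot mu (fun x => m x / s)) //.
- by rewrite divr_ge0 ?normr_ge0 // ltW.
- move=> y; rewrite -[in RHS]hm mulr_suml; apply: eq_bigr => z _.
  by rewrite mulrAC.
- by rewrite -mulr_suml mu1 divff // gt_eqF.
Qed.
End Markov.

(** * Linearity and matrix words *)

Section Sums.
Variables (K : numFieldType) (dim : option nat).

(** In infinite dimension this is the linearity of convergent series; the
    summability of the terms is what the definedness of all products supplies
    in the applications. *)
Lemma idx_sum_lincomb (I : Type) (r : seq I) (c : I -> K)
    (f : I -> idx dim -> K) :
  (forall o, idx_summable (f o)) ->
  idx_summable (fun k => \sum_(o <- r) c o * f o k) /\
  idx_sum (fun k => \sum_(o <- r) c o * f o k)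
    = \sum_(o <- r) c o * idx_sum (f o).
Proof.
case: dim f => [n|] f hf /=.
  split=> //; rewrite exchange_big /=; apply: eq_bigr => o _.
  by rewrite mulr_sumr.
elim: r => [|o r [IHc IHl]].
  have -> : series (fun k => \sum_(o <- [::]) c o * f o k) = fun=> 0.
    by apply/funext => n; rewrite /series /= big1 // => k _; rewrite big_nil.
  by rewrite big_nil; split; [exact: is_cvg_cst | exact: lim_cst].
have -> : series (fun k => \sum_(j <- o :: r) c j * f j k)
  = (fun n => c o * series (f o) n + series (fun k => \sum_(j <- r) c j * f j k) n).
  apply/funext => n; rewrite /series /= mulr_sumr -big_split /=.
  by apply: eq_bigr => k _; rewrite big_cons.
have cv : ((fun n => c o * series (f o) n
      + series (fun k => \sum_(j <- r) c j * f j k) n) @ \oo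
    --> \sum_(j <- o :: r) c j * limn (series (f j)))%classic.
  by rewrite big_cons -IHl; apply: cvgD => //; apply: cvgMl_tmp; apply: hf.
by split; [apply: cvgP cv | apply: cvg_lim cv].
Qed.

Lemma gmul_lincombr (s t : Defs.shape) (I : Type) (r : seq I) (c : I -> K)
    (A : gmx K dim s Full) (B : I -> gmx K dim Full t) :
  (forall o, gmul_defined A (B o)) ->
  A ** (fun i j => \sum_(o <- r) c o * B o i j)
    = (fun i j => \sum_(o <- r) c o * (A ** B o) i j).
Proof.
move=> hAB; apply/funext => i; apply/funext => j.
rewrite -(idx_sum_lincomb r c (fun o => hAB o i j)).2; congr idx_sum.
apply/funext => k; rewrite mulr_sumr; apply: eq_bigr => o _.
by rewrite mulrCA.
Qed.

Lemma gmul_lincombl (s t : Defs.shape) (I : Type) (r : seq I) (c : I -> K)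
    (A : I -> gmx K dim s Full) (B : gmx K dim Full t) :
  (forall o, gmul_defined (A o) B) ->
  (fun i j => \sum_(o <- r) c o * A o i j) ** B
    = (fun i j => \sum_(o <- r) c o * (A o ** B) i j).
Proof.
move=> hAB; apply/funext => i; apply/funext => j.
rewrite -(idx_sum_lincomb r c (fun o => hAB o i j)).2; congr idx_sum.
by apply/funext => k; rewrite mulr_suml; apply: eq_bigr => o _; rewrite mulrA.
Qed.

End Sums.

Section Words.
Variables (K : numFieldType) (dim : option nat).
Variables (D E : dir -> gmx K dim Full Full).
Variables (W : gmx K dim One Full) (V : gmx K dim Full One).
Hypothesis hdef : products_well_defined D E W V.
Hypothesis hassoc : products_associative D E W V.

Definition arrow_mx (l : bool * dir) : gmx K dim Full Full :=
  if l.1 then D l.2 else E l.2.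

Definition weight (w : seq (bool * dir)) : K := sandwich W (map arrow_mx w) V.

Definition arrow_expr (l : bool * dir) : prod_expr Full Full :=
  if l.1 then Leaf (LD l.2) else Leaf (LE l.2).

Definition arrow_letter (l : bool * dir) : letter :=
  if l.1 then LD l.2 else LE l.2.

(** Left-nested, as [sandwich] multiplies; [col_expr] is right-nested, so that
    a word can be cut at any place into a row times a column. *)
Definition row_expr (w : seq (bool * dir)) : prod_expr One Full :=
  foldl (fun e l => Prod e (arrow_expr l)) (Leaf LW) w.

Definition col_expr (w : seq (bool * dir)) : prod_expr Full One :=
  foldr (fun l e => Prod (arrow_expr l) e) (Leaf LV) w.

Notation val := (expr_val D E W V).

Lemma arrow_exprE l : val (arrow_expr l) = arrow_mx l.
Proof. by case: l => [[]]. Qed.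

Lemma arrow_expr_word l : expr_word (arrow_expr l) = [:: arrow_letter l].
Proof. by case: l => [[]]. Qed.

Lemma row_exprE w : val (row_expr w) = foldl (fun A M => A ** M) W (map arrow_mx w).
Proof.
elim/last_ind: w => [//|w l IHw].
by rewrite /row_expr map_rcons !foldl_rcons /= -/(row_expr w) IHw arrow_exprE.
Qed.

Lemma row_expr_word w : expr_word (row_expr w) = LW :: map arrow_letter w.
Proof.
elim/last_ind: w => [//|w l IHw].
rewrite /row_expr map_rcons foldl_rcons /= -/(row_expr w) IHw arrow_expr_word.
by rewrite cats1.
Qed.

Lemma col_expr_word w : expr_word (col_expr w) = rcons (map arrow_letter w) LV.
Proof. by elim: w => [//|l w IHw] /=; rewrite IHw arrow_expr_word. Qed.

(** Associativity compares any two bracketings of a word, so each relation can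
    be applied in the bracketing that suits it. *)
Lemma weight_expr (w : seq (bool * dir)) (e : prod_expr One One) :
  expr_word e = LW :: rcons (map arrow_letter w) LV ->
  weight w = val e tt tt.
Proof.
move=> he; transitivity (val (Prod (row_expr w) (Leaf LV)) tt tt).
  by rewrite /weight /sandwich /= row_exprE.
by apply: hassoc; rewrite he /= row_expr_word cats1.
Qed.

Lemma expr_gmul_defined (s t : Defs.shape) (e1 : prod_expr s Full)
  (e2 : prod_expr Full t) : gmul_defined (val e1) (val e2).
Proof. by case: (hdef (Prod e1 e2)). Qed.

(** The bracketing row * ((x * y) * column) isolates x * y, and each product
    around it is linear. *)
Lemma weight_bulk (u w : seq (bool * dir)) (x y : bool * dir)
    (I : Type) (r : seq I) (c : I -> K) (x' y' : I -> bool * dir) :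
  arrow_mx x ** arrow_mx y
    = (fun i j => \sum_(o <- r) c o * (arrow_mx (x' o) ** arrow_mx (y' o)) i j) ->
  weight (u ++ x :: y :: w) = \sum_(o <- r) c o * weight (u ++ x' o :: y' o :: w).
Proof.
move=> hxy.
pose e x y := Prod (row_expr u)
  (Prod (Prod (arrow_expr x) (arrow_expr y)) (col_expr w)).
have weE x1 y1 : weight (u ++ x1 :: y1 :: w) = val (e x1 y1) tt tt.
  apply: weight_expr; rewrite /= row_expr_word col_expr_word !arrow_expr_word.
  by rewrite map_cat rcons_cat.
have vE x1 y1 : val (e x1 y1) = val (row_expr u)
    ** ((arrow_mx x1 ** arrow_mx y1) ** val (col_expr w)).
  by rewrite /= !arrow_exprE.
rewrite weE vE hxy gmul_lincombl => [|o]; last first.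
  have := expr_gmul_defined
    (Prod (arrow_expr (x' o)) (arrow_expr (y' o))) (col_expr w).
  by rewrite /= !arrow_exprE.
rewrite gmul_lincombr => [|o]; last first.
  have := expr_gmul_defined (row_expr u)
    (Prod (Prod (arrow_expr (x' o)) (arrow_expr (y' o))) (col_expr w)).
  by rewrite /= !arrow_exprE.
by apply: eq_bigr => o _; rewrite weE vE.
Qed.

Lemma weight_left (w : seq (bool * dir)) (x : bool * dir)
    (I : Type) (r : seq I) (c : I -> K) (x' : I -> bool * dir) :
  W ** arrow_mx x = (fun i j => \sum_(o <- r) c o * (W ** arrow_mx (x' o)) i j) ->
  weight (x :: w) = \sum_(o <- r) c o * weight (x' o :: w).
Proof.
move=> hx.
pose e x := Prod (Prod (Leaf LW) (arrow_expr x)) (col_expr w).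
have weE x1 : weight (x1 :: w) = val (e x1) tt tt.
  by apply: weight_expr; rewrite /= col_expr_word !arrow_expr_word.
have vE x1 : val (e x1) = (W ** arrow_mx x1) ** val (col_expr w).
  by rewrite /= !arrow_exprE.
rewrite weE vE hx gmul_lincombl => [|o]; last first.
  have := expr_gmul_defined (Prod (Leaf LW) (arrow_expr (x' o))) (col_expr w).
  by rewrite /= !arrow_exprE.
by apply: eq_bigr => o _; rewrite weE vE.
Qed.

Lemma weight_right (u : seq (bool * dir)) (x : bool * dir)
    (I : Type) (r : seq I) (c : I -> K) (x' : I -> bool * dir) :
  arrow_mx x ** V = (fun i j => \sum_(o <- r) c o * (arrow_mx (x' o) ** V) i j) ->
  weight (rcons u x) = \sum_(o <- r) c o * weight (rcons u (x' o)).
Proof.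
move=> hx.
pose e x := Prod (row_expr u) (Prod (arrow_expr x) (Leaf LV)).
have weE x1 : weight (rcons u x1) = val (e x1) tt tt.
  apply: weight_expr; rewrite /= row_expr_word !arrow_expr_word.
  by rewrite map_rcons -!cats1 -catA.
have vE x1 : val (e x1) = val (row_expr u) ** (arrow_mx x1 ** V).
  by rewrite /= !arrow_exprE.
rewrite weE vE hx gmul_lincombr => [|o]; last first.
  have := expr_gmul_defined (row_expr u) (Prod (arrow_expr (x' o)) (Leaf LV)).
  by rewrite /= !arrow_exprE.
by apply: eq_bigr => o _; rewrite weE vE.
Qed.

Lemma big_tuple_rcons n (f : seq bool -> K) :
  \sum_(t : n.+1.-tuple bool) f t
    = \sum_(t : n.-tuple bool) \sum_(b : bool) f (rcons t b).
Proof.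
rewrite pair_big /=.
pose h (p : n.-tuple bool * bool) : n.+1.-tuple bool := [tuple of rcons p.1 p.2].
rewrite (reindex h) //=.
exists (fun t : n.+1.-tuple bool => ([tuple of belast (thead t) (behead t)],
   last (thead t) (behead t))) => [[t b] _|t _].
  apply/eqP; rewrite /h xpair_eqE /=; apply/andP; split.
    apply/eqP/val_inj => /=; rewrite /thead (tnth_nth false) /=.
    by case: (tval t) => //= x s; rewrite belast_rcons.
  rewrite /thead (tnth_nth false) /=; case: (tval t) => //= x s.
  by rewrite last_rcons.
apply/val_inj; rewrite /h /= -lastI; case/tupleP: t => x t /=.
by rewrite theadE.
Qed.

(** The matrices E + D are not letters, so associativity is not known for
    their products.  The row vector is instead expanded one factor at a time
    from the left, every term of the expansion being a product of letters. *)
Lemma sandwich_sum (ps : seq dir) :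
  sandwich W [seq (fun k l => E p k l + D p k l) | p <- ps] V
    = \sum_(t : (size ps).-tuple bool) weight (zip t ps).
Proof.
pose rowv (t : seq bool) (ps : seq dir) := val (row_expr (zip t ps)).
have rowE : foldl (fun A M => A ** M) W [seq (fun k l => E p k l + D p k l) | p <- ps]
   = fun i j => \sum_(t : (size ps).-tuple bool) 1 * rowv t ps i j.
  elim/last_ind: ps => [|ps p IHps].
    apply/funext => i; apply/funext => j /=.
    rewrite (bigD1 [tuple]) //= mul1r big1 ?addr0 // => t /eqP[].
    exact: tuple0.
  rewrite map_rcons foldl_rcons IHps.
  have sumE : (fun k l => E p k l + D p k l)
     = fun i j => \sum_(b : bool) 1 * val (arrow_expr (b, p)) i j.
    by apply/funext => k; apply/funext => l; rewrite big_bool /= !mul1r addrC.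
  rewrite sumE gmul_lincombr => [|b]; last first.
    move=> i j; under eq_fun do rewrite mulr_suml.
    under eq_fun do under eq_bigr do rewrite -mulrA.
    apply: (idx_sum_lincomb _ (fun _ => 1) _).1 => t.
    exact: (expr_gmul_defined (row_expr (zip t ps)) (arrow_expr (b, p))).
  apply/funext => i; apply/funext => j.
  rewrite size_rcons (@big_tuple_rcons _ (fun t => 1 * rowv t (rcons ps p) i j)).
  rewrite exchange_big /=; apply: eq_bigr => b _.
  rewrite gmul_lincombl => [|t]; last first.
    exact: (expr_gmul_defined (row_expr (zip t ps)) (arrow_expr (b, p))).
  rewrite mul1r; apply: eq_bigr => t _.
  by rewrite !mul1r /rowv zip_rcons ?size_tuple // /row_expr foldl_rcons.
rewrite /sandwich rowE gmul_lincombl => [|t]; last first.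
  exact: (expr_gmul_defined (row_expr (zip t ps)) (Leaf LV)).
apply: eq_bigr => t _; rewrite mul1r /weight /sandwich /rowv.
by rewrite row_exprE.
Qed.

End Words.

(** * Down-right paths as height functions *)

(** A down-right path meets each line x - y = k in exactly one vertex, so it is
    determined by the ordinates h k of these vertices. *)
Definition height_path (N : nat) (h : nat -> nat) : seq vertex :=
  [seq (h k + k, h k)%N | k <- iota 0 N.+1].

(** A right step keeps the ordinate, a down step lowers it by one. *)
Definition descending (N : nat) (h : nat -> nat) : Prop :=
  forall k, (k < N)%N -> h k = h k.+1 \/ h k = (h k.+1).+1.

(** The outgoing edge joining lines k and k + 1: above a right step it goes up
    from the end of the step, above a down step it goes right from its start. *)
Definition edge_at (h : nat -> nat) (k : nat) : edge :=
  if h k == h k.+1 then ((h k.+1 + k.+1, h k.+1)%N, Up)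
  else ((h k + k, h k)%N, Right).

Definition raise (h : nat -> nat) (k : nat) : nat -> nat :=
  fun j => if j == k then (h k).+1 else h j.

(** The vertex that [raise] passes is the one just above the path on line k.
    The condition says that those of its incoming edges that lie in the strip
    are outgoing edges of the path. *)
Definition raisable (N : nat) (h : nat -> nat) (k : nat) : bool :=
  [&& (k <= N)%N, (k == 0%N) || (h k.-1 == (h k).+1)
    & (k == N) || (h k.+1 == h k)].

Lemma down_right_heights N P : down_right_path N P ->
  exists2 h, P = height_path N h & descending N h.
Proof.
case: P => [//|v s] /and4P[_ hs hl hr].
pose P := v :: s; pose h k := (nth (0, 0)%N P k).2.
have step k : (k < size s)%N ->
    down_right_step (nth (0, 0)%N P k) (nth (0, 0)%N P k.+1).
  by move=> lt_k; move/(pathP (0, 0)%N): hs => /(_ k lt_k).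
have line k : (k <= size s)%N -> (nth (0, 0)%N P k).1 = (h k + k)%N.
  elim: k => [|k IHk] lek; first by rewrite /h addn0 /=; apply/eqP.
  have := IHk (ltnW lek); have := step _ lek; rewrite /down_right_step /h.
  case: (nth _ P k.+1) (nth _ P k) => x y [x' y'] /=.
  by rewrite !xpair_eqE /= => /orP[] /andP[/eqP -> /eqP ->]; lia.
have szN : size s = N.
  move: hr; rewrite /right_boundary (last_nth (0, 0)%N) -/P line //.
  by move=> /eqP /addnI ->.
exists h.
  apply: (@eq_from_nth _ (0, 0)%N); first by rewrite size_map size_iota /= szN.
  move=> i lti; rewrite /= szN in lti.
  rewrite (nth_map 0%N) ?size_iota // nth_iota // add0n -line; last by rewrite szN.
  exact: surjective_pairing.
move=> k; rewrite -szN => ltk; have := step _ ltk.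
have := line _ (ltnW ltk); have := line _ ltk; rewrite /down_right_step /h.
case: (nth _ P k.+1) (nth _ P k) => x y [x' y'] /=.
by rewrite !xpair_eqE /= => _ _ /orP[] /andP[_ /eqP ->]; [left|right].
Qed.

Lemma mem_height_path N h x y :
  ((x, y) \in height_path N h) = [&& (y <= x <= y + N)%N & h (x - y)%N == y].
Proof.
apply/mapP/idP => [[k]|/andP[/andP[lexy ley] /eqP hy]].
  by rewrite mem_iota => /andP[_ ltk] [-> ->]; rewrite addKn eqxx; lia.
by exists (x - y)%N; rewrite ?mem_iota ?hy; [lia | congr pair; lia].
Qed.

(** Between lines k and k + 1 there are two candidates, the right edge from
    line k and the up edge from line k + 1; exactly one of them leaves the path.
    In the induction over prefixes of the path, R holds the edge of the last
    vertex that leads to the line not yet visited. *)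
Lemma outgoing_edges_height N h : descending N h ->
  outgoing_edges N (height_path N h) = [seq edge_at h k | k <- iota 0 N].
Proof.
move=> hh; rewrite /outgoing_edges.
pose P := height_path N h.
pose R k := if (k < N)%N && (h k != h k.+1) then [:: edge_at h k] else [::].
suff H m : (m <= N)%N ->
  [seq e <- [seq (v, d) | v <- [seq (h k + k, h k)%N | k <- iota 0 m.+1],
     d <- [:: Up; Right]] | in_strip N (target e) & target e \notin P]
  = [seq edge_at h k | k <- iota 0 m] ++ R m.
  by have := H N (leqnn N); rewrite /R ltnn cats0.
elim: m => [|m IHm] lem.
  rewrite /= /R /in_strip /target /= /P !mem_height_path /edge_at.
  have -> : (h 0 < h 0 + 0 = false)%N by lia.
  rewrite /=.
  case: (ltnP 0 N) => hN /=; last first.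
    by case: ifP => //; lia.
  have -> : ((h 0 + 0).+1 - h 0 = 1)%N by lia.
  have -> : (h 0 <= (h 0 + 0).+1 <= h 0 + N)%N by lia.
  by case: (eqVneq (h 0) (h 1)).
have iotaSr n : iota 0 n.+1 = iota 0 n ++ [:: n] by rewrite -addn1 iotaD.
rewrite (iotaSr m.+1) map_cat allpairs_cat filter_cat IHm; last by lia.
rewrite (iotaSr m) map_cat -!catA.
congr (_ ++ _).
rewrite /= /R lem /edge_at /in_strip /target /= /P !mem_height_path /=.
have -> : (h m.+1 + m.+1 - (h m.+1).+1 = m)%N by lia.
have -> : ((h m.+1 + m.+1).+1 - h m.+1 = m.+2)%N by lia.
have -> : ((h m.+1) < h m.+1 + m.+1 <= (h m.+1).+1 + N)%N = true by lia.
have -> : (h m.+1 <= (h m.+1 + m.+1).+1 <= h m.+1 + N)%N = (m.+1 < N)%N by lia.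
have -> : (h m == (h m.+1).+1) = (h m != h m.+1) by have := hh m lem; lia.
rewrite (eq_sym (h m.+2)).
by case: (m.+1 < N)%N (h m == h m.+1) (h m.+1 == h m.+2) => [] [] [].
Qed.

(** A left inverse of [edge_at h], the same for all h; it shows that the
    outgoing edges are distinct. *)
Definition edge_gap (e : edge) : nat :=
  (e.1.1 - e.1.2 - (if e.2 is Up then 1 else 0))%N.

Lemma edge_atK h : cancel (edge_at h) edge_gap.
Proof.
by move=> k; rewrite /edge_at /edge_gap; case: ifP => _ /=; lia.
Qed.

Lemma out_edge_height N h i : descending N h -> (i < N)%N ->
  out_edge N (height_path N h) i = edge_at h i.
Proof.
move=> hh ltiN; rewrite /out_edge outgoing_edges_height //.
by rewrite (nth_map 0%N) ?size_iota // nth_iota.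
Qed.

Lemma index_edge_at N h i : descending N h -> (i < N)%N ->
  index (edge_at h i) (outgoing_edges N (height_path N h)) = i.
Proof.
move=> hh ltiN; rewrite outgoing_edges_height // index_map.
  by rewrite -{1}[i]add0n -(nth_iota 0 0 ltiN) index_uniq ?iota_uniq ?size_iota.
exact: can_inj (edge_atK h).
Qed.

Lemma shift_height N h :
  shift 1 (height_path N h) = height_path N (fun k => (h k).+1).
Proof.
rewrite /shift /height_path -map_comp; apply: eq_map => k /=.
by congr pair; lia.
Qed.

Fixpoint raised_vertices (h : nat -> nat) (ks : seq nat) : seq vertex :=
  if ks is k :: ks' then
    ((h k).+1 + k, (h k).+1)%N :: raised_vertices (raise h k) ks'
  else [::].

Fixpoint admissible (N : nat) (h : nat -> nat) (ks : seq nat) : bool :=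
  if ks is k :: ks' then raisable N h k && admissible N (raise h k) ks'
  else true.

(** The sampling order of the new vertices of lines j and k: by ordinate, then
    by abscissa, which at equal ordinates is the order of the lines. *)
Definition line_before (h : nat -> nat) : rel nat :=
  fun j k => (h j < h k)%N || ((h j == h k) && (j < k)%N).

(** When line k is about to be raised, line k - 1 must already be raised if it
    started at the same height, and must not be if it started one higher; line
    k + 1 must not be raised if it started at the same height, and must be if it
    started one lower.  The sampling order decides these four cases correctly.
    The list done holds the lines raised so far. *)
Lemma line_before_admissible N (h0 : nat -> nat) (ks done : seq nat)
    (h := fun j => (h0 j + (j \in done))%N) :
  descending N h0 -> pairwise (line_before h0) ks ->
  (forall j, (j <= N)%N = (j \in done) || (j \in ks)) ->
  {in done & ks, forall j k, line_before h0 j k} ->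
  [/\ admissible N h ks,
      raised_vertices h ks = [seq ((h0 k).+1 + k, (h0 k).+1)%N | k <- ks]
    & forall j, (j <= N)%N -> foldl raise h ks j = (h0 j).+1].
Proof.
move=> hh.
elim: ks done @h => [|k ks IHks] done h hpw hdone hlt.
  split=> // j; rewrite hdone in_nil orbF => hj.
  by rewrite /= /h hj addn1.
move: hpw; rewrite /= => /andP[/allP hk hpw].
have irr j : line_before h0 j j = false.
  by rewrite /line_before ltnn eqxx ltnn.
have kNdone : k \notin done.
  by apply/negP => kd; have := hlt k k kd (mem_head _ _); rewrite irr.
have hkE : h k = h0 k by rewrite /h (negPf kNdone) addn0.
have hraise : raise h k = (fun j => h0 j + (j \in k :: done))%N.
  apply/funext => j; rewrite /raise in_cons; case: (eqVneq j k) => [->|//] /=.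
  by rewrite hkE addn1.
have [||adm vsE fin] := IHks (k :: done) hpw.
- by move=> j; rewrite hdone !in_cons orbA [in RHS](orbC (j == k)).
- move=> i j; rewrite in_cons => /orP[/eqP -> /hk //|id jks].
  by apply: hlt => //; rewrite in_cons jks orbT.
have leN : (k <= N)%N by rewrite hdone mem_head orbT.
split=> /=; last 2 first.
- by rewrite hkE hraise vsE.
- by move=> j lej; rewrite hraise fin.
rewrite hraise adm andbT /raisable leN /= !hkE /h.
have later j : line_before h0 k j -> j \notin done.
  move=> kj; apply/negP => jd; have := hlt j k jd (mem_head _ _).
  by move: kj; rewrite /line_before; lia.
have earlier j : (j <= N)%N -> line_before h0 j k -> j \in done.
  move=> lej jk; move: (lej); rewrite hdone in_cons => /or3P[// | /eqP jk' | jks].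
    by move: jk; rewrite jk' irr.
  by have := hk j jks; move: jk; rewrite /line_before; lia.
apply/andP; split.
  case: k {hkE hraise hk kNdone hpw hlt adm vsE fin hdone} leN later earlier
    => [//|k] leN later earlier /=.
  have [e|e] := hh k leN.
    by rewrite earlier ?e ?addn1 //; [lia | rewrite /line_before; lia].
  rewrite (negPf (later k _)) ?e ?addn0 //; rewrite /line_before; lia.
case: (eqVneq k N) => //= neN; have ltN : (k < N)%N by lia.
have [e|e] := hh k ltN.
  by rewrite (negPf (later k.+1 _)) ?e ?addn0 //; rewrite /line_before; lia.
by rewrite earlier ?e ?addn1 //; rewrite /line_before; lia.
Qed.

(** On each line exactly one vertex lies above the path and on or below its
    translate by (1, 1).  The grid from which these vertices are filtered is
    listed by ordinate and then abscissa, and filtering keeps this order. *)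
Lemma vertices_between_lines N h : descending N h -> exists ks,
  [/\ vertices_between N (height_path N h) (height_path N (fun k => (h k).+1))
        = [seq ((h k).+1 + k, (h k).+1)%N | k <- ks],
      pairwise (line_before h) ks & forall j, (j <= N)%N = (j \in ks)].
Proof.
move=> hh.
pose L := vertices_between N (height_path N h) (height_path N (fun k => (h k).+1)).
have hasE (R : rel nat) (g : nat -> nat) x y : (y <= x <= y + N)%N ->
    has (fun u => (u.1 + y == x + u.2)%N && R u.2 y) (height_path N g)
    = R (g (x - y)%N) y.
  move=> hxy; apply/hasP/idP => [[u /mapP[k]]|hR].
    rewrite mem_iota => /andP[_ ltk] -> /= /andP[/eqP e].
    by have -> : (x - y = k)%N by lia.
  exists (g (x - y) + (x - y), g (x - y))%N; last by rewrite /= hR andbT; lia.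
  by apply: map_f; rewrite mem_iota; lia.
have memL v : (v \in L)
    = (v.2 <= v.1 <= v.2 + N)%N && (v.2 == (h (v.1 - v.2)%N).+1).
  case: v => x y; rewrite mem_filter.
  rewrite -[X in X && (_ == _)]/(y <= x <= y + N)%N.
  case: (boolP (y <= x <= y + N)%N) => hxy; last first.
    apply/negP => /andP[_ /allpairsPdep [y' [x' [_]]]].
    by rewrite mem_iota => hx [ex ey]; lia.
  rewrite /weakly_above /weakly_below [(_, _).1]/= [(_, _).2]/=.
  rewrite (hasE (fun u w => u <= w)%N) // (hasE (fun u w => w <= u)%N) //.
  rewrite mem_height_path hxy andTb.
  case: (boolP (y == (h (x - y)).+1)%N) => hy; last first.
    by apply/negP => /andP[/and3P[]]; lia.
  apply/andP; split; first by lia.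
  apply/allpairsPdep; exists y, x; split=> //; last by rewrite mem_iota; lia.
  rewrite mem_iota add0n ltnS leq0n /=.
  apply: (@leq_bigmax_seq _ _ xpredT (fun u : vertex => u.2) (x, y)) => //.
  by rewrite mem_height_path hxy eq_sym.
have pwL : pairwise (fun v w : vertex =>
    (v.2 < w.2)%N || (v.2 == w.2) && (v.1 < w.1)%N) L.
  apply: pairwise_filter; set r := (X in pairwise X).
  suff pw M m : pairwise r [seq (x, y) | y <- iota m M, x <- iota y N.+1] by [].
  elim: M m => [//|M IHM] m; rewrite -[iota m M.+1]/(m :: iota m.+1 M).
  rewrite allpairs_cons pairwise_cat IHM andbT; apply/andP; split.
    apply/allrelP => v w /mapP[x _ ->] /allpairsPdep[y' [x' [hy _ ->]]].
    by move: hy; rewrite mem_iota /r /=; lia.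
  rewrite pairwise_map -[X in pairwise X]/(fun x x' => r (x, m) (x', m)).
  have : pairwise ltn (iota m N.+1).
    by rewrite -sorted_pairwise ?iota_ltn_sorted //; apply: ltn_trans.
  by apply: sub_pairwise => x x' /= ltx; rewrite /r /= eqxx ltx orbT.
exists [seq (v.1 - v.2)%N | v <- L]; split.
- rewrite -map_comp -[LHS]map_id; apply/eq_in_map => -[x y].
  by rewrite memL /= => /andP[hxy /eqP <-]; congr pair; lia.
- rewrite pairwise_map; move: pwL.
  apply: (@sub_in_pairwise _ (mem L)); last exact/allP.
  move=> [x y] [x' y'] hv hw; have : (x, y) \in L := hv; have : (x', y') \in L := hw.
  rewrite !memL /= /line_before => /andP[hxy /eqP e] /andP[hxy' /eqP e'].
  lia.
- move=> j; apply/idP/mapP => [lej|[[x y]]].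
    by exists ((h j).+1 + j, (h j).+1)%N; rewrite ?memL /= addKn ?eqxx //; lia.
  by rewrite memL /= => /andP[hv _] ->; lia.
Qed.

(** * The dynamics on configurations *)

(** Positions k - 1 and k of a configuration are the left and bottom edges of
    the vertex passed on line k, and afterwards its top and right edges.  On a
    boundary line one of the two positions does not exist, and the
    corresponding bit is dropped. *)
Definition set_line (N k : nat) (t r : bool) (tau : config N) : config N :=
  [tuple if i.+1 == k then t else if i == k :> nat then r else tnth tau i
     | i < N].

Lemma nth_set_line N k t r (tau : config N) i : (i < N)%N ->
  nth false (set_line k t r tau) i
    = if i.+1 == k then t else if i == k then r else nth false tau i.
Proof.
move=> ltiN; rewrite -(tnth_nth _ _ (Ordinal ltiN)) tnth_mktuple /=.
by rewrite (tnth_nth false).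
Qed.

Lemma eq_config N (tau tau' : config N) :
  (forall i, (i < N)%N -> nth false tau i = nth false tau' i) -> tau = tau'.
Proof.
by move=> h; apply: eq_from_tnth => i; rewrite !(tnth_nth false) h.
Qed.

Lemma set_line_idem N k t r t' r' (tau : config N) :
  set_line k t r (set_line k t' r' tau) = set_line k t r tau.
Proof.
apply: eq_config => i lti; rewrite !nth_set_line //.
by case: (i.+1 == k); case: (i == k).
Qed.

Lemma set_line_id N k (tau : config N) :
  set_line k (nth false tau k.-1) (nth false tau k) tau = tau.
Proof.
apply: eq_config => i lti; rewrite !nth_set_line //.
by case: eqP => [<- //|_]; case: eqP => [->|].
Qed.

Lemma sum_bool2 (V : nmodType) (G : bool * bool -> V) :
  \sum_o G o = (G (true, true) + G (true, false))
             + (G (false, true) + G (false, false)).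
Proof.
transitivity (\sum_x \sum_y G (x, y)); last by rewrite !big_bool.
by rewrite pair_bigA; apply: eq_bigr => -[].
Qed.

(** Adding a fixed mask modulo 2 to the two bits permutes the configurations;
    summing over the four masks at each configuration runs over the four
    values of the two bits.  The same count holds on boundary lines, where the
    dropped bit only causes repetitions. *)
Lemma sum_set_line (K : numFieldType) N k (f : config N -> K) :
  (\sum_tau f tau) *+ 4 = \sum_tau \sum_(o : bool * bool) f (set_line k o.1 o.2 tau).
Proof.
pose flip (m : bool * bool) (tau : config N) : config N :=
  set_line k (m.1 (+) nth false tau k.-1) (m.2 (+) nth false tau k) tau.
have flipK m : involutive (flip m).
  move=> tau; rewrite /flip set_line_idem; apply: eq_config => i lti.
  rewrite nth_set_line //; case: eqP => [<-|ik] /=.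
    by rewrite nth_set_line // eqxx addKb.
  by case: eqP => // <-; rewrite nth_set_line // eqxx (gtn_eqF (ltnSn i)) addKb.
have -> : (\sum_tau f tau) *+ 4 = \sum_(m : bool * bool) \sum_tau f (flip m tau).
  rewrite [RHS](eq_bigr (fun=> \sum_tau f tau)) => [|m _].
    by rewrite sum_bool2; ring.
  by rewrite [RHS](reindex_inj (inv_inj (flipK m))).
rewrite exchange_big /=; apply: eq_bigr => tau _; rewrite !sum_bool2 /flip /=.
by case: (nth false tau k.-1) (nth false tau k) => [] [] /=; ring.
Qed.

(* Keeps simplification from unfolding the entries of an updated
   configuration, which [nth_set_line] computes. *)
Opaque set_line.

Section Process.
Variables (K : numFieldType) (N : nat) (a b c d th1 th2 : K).
Notation config := (config N).

(** The law at a vertex depends only on its line; (k, 0) represents line k. *)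
Definition line_prob (k : nat) : bool -> bool -> bool -> bool -> K :=
  vertex_prob N a b c d th1 th2 (k, 0%N).

(** The sampling procedure, reduced to the configuration on the frontier. *)
Fixpoint run (ks : seq nat) (F : config -> K) (tau : config) : K :=
  if ks is k :: ks' then
    \sum_(o : bool * bool)
       line_prob k (nth false tau k.-1) (nth false tau k) o.1 o.2
       * run ks' F (set_line k o.1 o.2 tau)
  else F tau.

Definition read (h : nat -> nat) (s : arrows) : config :=
  [tuple s (edge_at h i) | i < N].

Lemma nth_read h s i : (i < N)%N -> nth false (read h s) i = s (edge_at h i).
Proof.
by move=> lti; rewrite -(tnth_nth _ _ (Ordinal lti)) tnth_mktuple.
Qed.

Lemma vertex_prob_line k y l s t r : (k <= N)%N ->
  vertex_prob N a b c d th1 th2 (y + k, y)%N l s t r = line_prob k l s t r.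
Proof.
move=> lek; rewrite /line_prob /vertex_prob /left_boundary /right_boundary /=.
by rewrite add0n eqn_add2l -{2}[y]addn0 eqn_add2l.
Qed.

(** The bottom edge of a right boundary vertex lies outside the strip. *)
Lemma line_probN l s s' t r : (0 < N)%N ->
  line_prob N l s t r = line_prob N l s' t r.
Proof.
move=> N0; rewrite /line_prob /vertex_prob /left_boundary /right_boundary /=.
by rewrite add0n eqxx; case: eqP => [e|//]; move: N0; rewrite e.
Qed.

Lemma read_raise h k t r s : raisable N h k ->
  read (raise h k) (set_out ((h k).+1 + k, (h k).+1)%N t r s)
    = set_line k t r (read h s).
Proof.
move=> /and3P[lek hl hr]; apply: eq_config => i lti.
rewrite nth_set_line // !nth_read // /edge_at /raise /set_out.
case: (eqVneq i.+1 k) => [e|ne1].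
  by move: hl; rewrite -e /= => /eqP ->; rewrite (ltn_eqF (ltnSn i)) !eqxx.
case: (eqVneq i k) => [e|ne2].
  rewrite e in lti *; move: hr; rewrite (ltn_eqF lti) /= => /eqP ->.
  by rewrite (gtn_eqF (ltnSn (h k))) !xpair_eqE /= !eqxx.
have neq j (p q : dir) : j != k ->
    (((h j + j, h j)%N, p) == (((h k).+1 + k, (h k).+1)%N, q)) = false.
  move=> ne; rewrite !xpair_eqE.
  by apply/negP => /andP[/andP[/eqP e1 /eqP e2] _]; move/eqP: ne; lia.
by case: (h i == h i.+1); rewrite !neq.
Qed.

(** At a raisable line the incoming edges in the strip are read off the
    frontier, and raising the line overwrites just these two positions. *)
Lemma sample_expect_run (F : config -> K) h ks s : (0 < N)%N -> admissible N h ks ->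
  sample_expect N a b c d th1 th2 (raised_vertices h ks)
    (fun s => F (read (foldl raise h ks) s)) s = run ks F (read h s).
Proof.
move=> N0; elim: ks h s => [//|k ks IHks] h s /= /andP[hk adm].
apply: eq_bigr => -[t r] _ /=.
rewrite IHks // read_raise //; congr (_ * _).
have /and3P[lek hl hr] := hk; rewrite vertex_prob_line //.
have -> : s (left_edge ((h k).+1 + k, (h k).+1)%N)
   = if k == 0%N then s (left_edge ((h k).+1 + k, (h k).+1)%N)
     else nth false (read h s) k.-1.
  case: eqP => // k0; rewrite nth_read /edge_at; last by lia.
  move: hl; rewrite prednK; last by lia.
  case: (k =P 0%N) k0 => // k0 _ /= /eqP e.
  by rewrite e eqn_leq ltnn /left_edge /=; congr (s (_, _, _)); lia.
have -> : s (bottom_edge ((h k).+1 + k, (h k).+1)%N)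
   = if k == N then s (bottom_edge ((h k).+1 + k, (h k).+1)%N)
     else nth false (read h s) k.
  case: eqP => // kN; rewrite nth_read /edge_at; last by lia.
  move: hr; case: (k =P N) kN => //= kN _ /eqP e.
  by rewrite e eqxx /bottom_edge /=; congr (s (_, _, _)); lia.
case: eqP => [->|k0]; case: eqP => [e|_] //.
- by rewrite -e in N0.
- by rewrite e; exact: line_probN.
Qed.

End Process.

(** * Transport of the matrix product weight *)

(** One possible outcome at the vertex of line k: an isolated arrow leaves to
    the right, and at the right boundary, where that edge is missing, it
    disappears; the left boundary neither creates nor destroys an arrow. *)
Definition push_line (N k : nat) (tau : config N) : config N :=
  if k == 0%N then tau else
  set_line k (nth false tau k.-1 && nth false tau k)
             (nth false tau k.-1 || nth false tau k) tau.

Notation push_lines ks tau := (foldl (fun t k => push_line k t) tau ks).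

(** Each arrow counts its distance to the exit on the right. *)
Definition potential (N : nat) (tau : config N) : nat :=
  (\sum_(i < N) nth false tau i * (N - i))%N.

Lemma push_line_potential N k (tau : config N) : (k <= N)%N ->
  push_line k tau = tau \/ (potential (push_line k tau) < potential tau)%N.
Proof.
move=> lek; rewrite /push_line; case: (eqVneq k 0%N) => [|k0]; first by left.
case El: (nth false tau k.-1); last first.
  by left; rewrite /= -[RHS](set_line_id k) El.
case Er: (nth false tau k).
  by left; rewrite /= -[RHS](set_line_id k) El Er.
right; rewrite /= /potential.
have ltk : (k.-1 < N)%N by lia.
rewrite (bigD1 (Ordinal ltk)) //= [ltnRHS](bigD1 (Ordinal ltk)) //=.
rewrite nth_set_line // prednK ?lt0n // eqxx El mul0n mul1n add0n.
pose g (i : 'I_N) := (nth false tau i * (N - i) + (i == k :> nat) * (N - k))%N.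
apply: (@leq_ltn_trans (\sum_(i < N | i != Ordinal ltk) g i)%N).
  apply: leq_sum => i; rewrite /g nth_set_line // -val_eqE /= => ne.
  have -> : (i.+1 == k) = false by lia.
  by case: eqP => [->|_] /=; lia.
rewrite /g big_split /= addnC ltn_add2r.
apply: (@leq_ltn_trans (N - k)); last by lia.
have [ltkN|leNk] := ltnP k N; last first.
  by rewrite big1 // => i _; have := ltn_ord i; case: eqP => //; lia.
rewrite (bigD1 (Ordinal ltkN)) /=; last by rewrite -val_eqE /=; lia.
rewrite eqxx mul1n big1 ?addn0 // => i /andP[_].
by rewrite -val_eqE /= => /negPf ->.
Qed.

Lemma push_lines_potential N ks (tau : config N) : {in ks, forall k, (k <= N)%N} ->
  (potential (push_lines ks tau) < potential tau)%N \/
  (push_lines ks tau = tau /\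
   {in ks, forall k, push_line k tau = tau}).
Proof.
elim: ks tau => [|k ks IHks] tau hks /=; first by right.
have hks' : {in ks, forall k, (k <= N)%N}.
  by move=> j hj; apply: hks; rewrite in_cons hj orbT.
have [e|lt1] := push_line_potential tau (hks k (mem_head _ _)).
  rewrite e; have [lt2|[e2 fix2]] := IHks tau hks'; [by left | right].
  by split=> // j; rewrite in_cons => /orP[/eqP ->|/fix2].
left; have [lt2|[-> _]] := IHks (push_line k tau) hks' => //.
exact: ltn_trans lt2 lt1.
Qed.

Definition empty_config (N : nat) : config N := [tuple false | i < N].

(** Going down from the right end: if position k is empty and pushing line k
    changes nothing, then position k - 1 is empty. *)
Lemma push_line_fixed N (tau : config N) :
  (forall k, (k <= N)%N -> push_line k tau = tau) -> tau = empty_config N.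
Proof.
move=> hfix; apply: eq_config => i lti.
rewrite -[RHS](tnth_nth _ _ (Ordinal lti)) tnth_mktuple.
have H m : (m <= N)%N -> nth false tau (N - m) = false.
  elim: m => [|m IHm] lem; first by rewrite subn0 nth_default ?size_tuple.
  have := congr1 (fun t : config N => nth false t (N - m.+1))
    (hfix (N - m)%N (leq_subr _ _)).
  rewrite /push_line ifF; last by lia.
  rewrite nth_set_line; last by lia.
  have -> : ((N - m.+1).+1 == N - m)%N by lia.
  by rewrite IHm ?andbF; [move=> <- | lia].
by have := H (N - i)%N (leq_subr _ _); rewrite subKn // ltnW.
Qed.

Lemma open_unit_gt0 (K : numFieldType) (x : K) : 0 < x < 1 -> 0 < x /\ 0 < 1 - x.
Proof. by case/andP=> ? ?; split=> //; rewrite subr_gt0. Qed.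

Section Run.
Variables (K : numFieldType) (N : nat) (a b c d th1 th2 : K).
Hypotheses (ha : 0 < a < 1) (hb : 0 < b < 1) (hc : 0 < c < 1) (hd : 0 < d < 1)
  (hth1 : 0 < th1 < 1) (hth2 : 0 < th2 < 1).
Notation config := (config N).
Notation prob := (line_prob N a b c d th1 th2).
Notation run := (@run K N a b c d th1 th2).

Lemma line_prob_ge0 k l s t r : 0 <= prob k l s t r.
Proof.
have [[a0 a1] [b0 b1]] := (open_unit_gt0 ha, open_unit_gt0 hb).
have [[c0 c1] [d0 d1]] := (open_unit_gt0 hc, open_unit_gt0 hd).
have [[t0 t1] [u0 u1]] := (open_unit_gt0 hth1, open_unit_gt0 hth2).
rewrite /line_prob /vertex_prob.
by case: (left_boundary (k, 0%N)); case: (right_boundary N (k, 0%N));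
   case: l s t r => [] [] [] [];
   rewrite ?lexx ?ler01 ?ltW.
Qed.

Lemma line_prob_sum1 k l s : \sum_o prob k l s o.1 o.2 = 1.
Proof.
rewrite sum_bool2 /line_prob /vertex_prob.
by case: (left_boundary (k, 0%N)); case: (right_boundary N (k, 0%N));
   case: l s => [] [] /=; ring.
Qed.

Lemma push_line_prob k (tau : config) : (k <= N)%N ->
  exists2 o : bool * bool,
    0 < prob k (nth false tau k.-1) (nth false tau k) o.1 o.2
    & push_line k tau = set_line k o.1 o.2 tau.
Proof.
have [[a0 a1] [b0 b1]] := (open_unit_gt0 ha, open_unit_gt0 hb).
have [[c0 c1] [d0 d1]] := (open_unit_gt0 hc, open_unit_gt0 hd).
have [[t0 t1] [u0 u1]] := (open_unit_gt0 hth1, open_unit_gt0 hth2).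
move=> lek; rewrite /push_line /line_prob /vertex_prob /left_boundary
  /right_boundary /= add0n.
case: (eqVneq k 0%N) => [->|k0].
  exists (false, nth false tau 0) => /=; first by case: nth.
  by rewrite -[LHS](set_line_id 0); apply: eq_config => i lti; rewrite !nth_set_line.
case: (eqVneq k N) => [kN|neN].
  have -> : nth false tau k = false by rewrite nth_default // size_tuple kN.
  exists (false, false) => /=; first by case: nth.
  rewrite andbF; apply: eq_config => i lti; rewrite !nth_set_line //.
  by rewrite [in i == k]kN (ltn_eqF lti).
exists (nth false tau k.-1 && nth false tau k,
        nth false tau k.-1 || nth false tau k) => //=.
by case: (nth false tau k.-1) (nth false tau k) => [] [] /=.
Qed.

Lemma run_ge0 ks F (tau : config) : (forall t, 0 <= F t) -> 0 <= run ks F tau.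
Proof.
move=> F0; elim: ks tau => [//|k ks IHks] tau /=.
by apply: sumr_ge0 => o _; rewrite mulr_ge0 ?line_prob_ge0.
Qed.

Lemma run_sum ks (tau : config) :
  \sum_t run ks (fun x => (x == t)%:R) tau = 1.
Proof.
elim: ks tau => [|k ks IHks] tau /=; first exact: sum_indicator.
rewrite exchange_big /=
  -[RHS](line_prob_sum1 k (nth false tau k.-1) (nth false tau k)).
by apply: eq_bigr => o _; rewrite -mulr_sumr IHks mulr1.
Qed.

Lemma run_push_gt0 ks (tau : config) : {in ks, forall k, (k <= N)%N} ->
  0 < run ks (fun x => (x == push_lines ks tau)%:R) tau.
Proof.
elim: ks tau => [|k ks IHks] tau hks /=; first by rewrite eqxx ltr01.
have [o po ->] := push_line_prob tau (hks k (mem_head _ _)).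
rewrite (bigD1 o) //= ltr_pwDl ?mulr_gt0 //.
  by apply: IHks => j hj; apply: hks; rewrite in_cons hj orbT.
apply: sumr_ge0 => o' _; rewrite mulr_ge0 ?line_prob_ge0 // run_ge0 //.
Qed.

End Run.

Definition dir_at (h : nat -> nat) (i : nat) : dir := (edge_at h i).2.

Definition word (N : nat) (h : nat -> nat) (tau : config N) : seq (bool * dir) :=
  [seq (nth false tau i, dir_at h i) | i <- iota 0 N].

Lemma dir_atE h i : dir_at h i = if h i == h i.+1 then Up else Right.
Proof. by rewrite /dir_at /edge_at; case: ifP. Qed.

(** Isolates the at most two letters that belong to the vertex of line k. *)
Lemma word_set_line N h (tau : config N) k t r : (k <= N)%N ->
  word h (set_line k t r tau) =
    [seq (nth false tau i, dir_at h i) | i <- iota 0 k.-1]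
    ++ (if k == 0%N then [::] else [:: (t, dir_at h k.-1)])
    ++ (if k == N then [::] else [:: (r, dir_at h k)])
    ++ [seq (nth false tau i, dir_at h i) | i <- iota k.+1 (N - k.+1)].
Proof.
move=> lek; rewrite /word.
have -> : iota 0 N = iota 0 k.-1 ++ (if k == 0%N then [::] else [:: k.-1])
    ++ (if k == N then [::] else [:: k]) ++ iota k.+1 (N - k.+1).
  have -> : (if k == 0%N then [::] else [:: k.-1]) = iota k.-1 (k != 0%N).
    by case: eqP.
  have -> : (if k == N then [::] else [:: k]) = iota k (k != N) by case: eqP.
  have -> : iota k.+1 (N - k.+1) = iota (k + (k != N)) (N - k.+1).
    case: (eqVneq k N) => [->|_]; last by rewrite addn1.
    by have -> : (N - N.+1 = 0)%N by lia.
  rewrite -iotaD -[X in iota X (_ + _)](_ : k.-1 + (k != 0%N) = k)%N; last by lia.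
  by rewrite -iotaD -[X in iota X (_ + (_ + _))]add0n -iotaD; congr iota; lia.
rewrite !map_cat; congr (_ ++ (_ ++ (_ ++ _))).
- apply/eq_in_map => i; rewrite mem_iota => lti; rewrite nth_set_line; last by lia.
  have -> : (i.+1 == k) = false by lia.
  by have -> : (i == k) = false by lia.
- case: (eqVneq k 0%N) => //= k0; rewrite nth_set_line; last by lia.
  by rewrite prednK ?eqxx // lt0n.
- case: (eqVneq k N) => //= kN; rewrite nth_set_line; last by lia.
  by rewrite eqxx gtn_eqF.
- apply/eq_in_map => i; rewrite mem_iota => lti; rewrite nth_set_line; last by lia.
  have -> : (i.+1 == k) = false by lia.
  by have -> : (i == k) = false by lia.
Qed.

Lemma dir_raise_other h k i : i.+1 != k -> i != k ->
  dir_at (raise h k) i = dir_at h i.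
Proof. by move=> ne1 ne2; rewrite !dir_atE /raise (negPf ne1) (negPf ne2). Qed.

Lemma word_raise_set_line N h (tau : config N) k t r : (k <= N)%N ->
  word (raise h k) (set_line k t r tau) =
    [seq (nth false tau i, dir_at h i) | i <- iota 0 k.-1]
    ++ (if k == 0%N then [::] else [:: (t, dir_at (raise h k) k.-1)])
    ++ (if k == N then [::] else [:: (r, dir_at (raise h k) k)])
    ++ [seq (nth false tau i, dir_at h i) | i <- iota k.+1 (N - k.+1)].
Proof.
move=> lek; rewrite word_set_line //; congr (_ ++ (_ ++ (_ ++ _)));
  apply/eq_in_map => i; rewrite mem_iota => lti; rewrite dir_raise_other //; lia.
Qed.

Lemma raisable_dirs N h k : raisable N h k ->
  ((0 < k)%N -> dir_at h k.-1 = Right /\ dir_at (raise h k) k.-1 = Up) /\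
  ((k < N)%N -> dir_at h k = Up /\ dir_at (raise h k) k = Right).
Proof.
move=> /and3P[lek hl hr]; split=> hk; rewrite !dir_atE /raise.
  move: hl; rewrite prednK // (gtn_eqF hk) /= => /eqP ->.
  by rewrite (gtn_eqF (ltnSn _)) if_same !eqxx.
move: hr; rewrite (ltn_eqF hk) /= => /eqP ->.
by rewrite !eqxx (gtn_eqF (ltnSn k)) (gtn_eqF (ltnSn _)).
Qed.

Section Invariance.
Variables (K : numFieldType) (N : nat) (a b c d th1 th2 : K).
Variables (wt : seq (bool * dir) -> K).
Hypothesis N0 : (0 < N)%N.
Notation config := (config N).
Notation prob := (line_prob N a b c d th1 th2).
Notation run := (@run K N a b c d th1 th2).

Hypothesis wt_bulk : forall k u w t r, (0 < k < N)%N ->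
  wt (u ++ (t, Up) :: (r, Right) :: w)
  = \sum_o prob k o.1 o.2 t r * wt (u ++ (o.1, Right) :: (o.2, Up) :: w).
Hypothesis wt_left : forall w l r,
  wt ((r, Right) :: w) = \sum_s prob 0 l s false r * wt ((s, Up) :: w).
Hypothesis wt_right : forall u s t,
  wt (rcons u (t, Up)) = \sum_l prob N l s t false * wt (rcons u (l, Right)).

(** After grouping the configurations that differ only at the two positions of
    line k, by [sum_set_line], the local relation applies to the letters at
    these positions, the rest of the word being fixed. *)
Lemma wt_step h k (G : config -> K) : raisable N h k ->
  \sum_(tau : config) wt (word h tau) *
     \sum_o prob k (nth false tau k.-1) (nth false tau k) o.1 o.2
        * G (set_line k o.1 o.2 tau)
  = \sum_(tau : config) wt (word (raise h k) tau) * G tau.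
Proof.
move=> hk; have /and3P[lek _ _] := hk.
have [dirl dirr] := raisable_dirs hk.
apply: (@pmulrnI _ 4) => //; rewrite !(sum_set_line k).
apply: eq_bigr => tau _.
have [k0|kpos] := posnP k.
  subst k; have [dh dh'] := dirr N0.
  have wE t r : word (raise h 0) (set_line 0 t r tau)
     = (r, Right) :: [seq (nth false tau i, dir_at h i) | i <- iota 1 (N - 1)].
    by rewrite word_raise_set_line //= (ltn_eqF N0) /= dh'.
  have wE' t r : word h (set_line 0 t r tau)
     = (r, Up) :: [seq (nth false tau i, dir_at h i) | i <- iota 1 (N - 1)].
    by rewrite word_set_line //= (ltn_eqF N0) /= dh.
  have setE t t' r : set_line 0 t r tau = set_line 0 t' r tau.
    by apply: eq_config => i lti; rewrite !nth_set_line.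
  (* The left-hand side sums over a spurious incoming bit for the missing
     position, the right-hand side over a spurious outgoing one, so each term
     occurs twice on both sides. *)
  under eq_bigr => o _ do rewrite wE'.
  under [RHS]eq_bigr => o _ do rewrite wE (wt_left _ true) big_bool.
  rewrite !sum_bool2 /= !set_line_idem !nth_set_line //=.
  rewrite !(setE true false) /line_prob /vertex_prob /=.
  ring.
have [kN|ltN] := eqVneq k N.
  subst k; have [dh dh'] := dirl N0.
  pose u := [seq (nth false tau i, dir_at h i) | i <- iota 0 N.-1].
  have wE t r : word (raise h N) (set_line N t r tau) = rcons u (t, Up).
    rewrite word_raise_set_line // (gtn_eqF N0) eqxx dh'.
    have -> : (N - N.+1 = 0)%N by lia.
    by rewrite cats1.
  have wE' t r : word h (set_line N t r tau) = rcons u (t, Right).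
    rewrite word_set_line // (gtn_eqF N0) eqxx dh.
    have -> : (N - N.+1 = 0)%N by lia.
    by rewrite cats1.
  have setE t r r' : set_line N t r tau = set_line N t r' tau.
    by apply: eq_config => i lti; rewrite !nth_set_line // (ltn_eqF lti).
  have nthl t r : nth false (set_line N t r tau) N.-1 = t.
    by rewrite nth_set_line ?prednK ?eqxx.
  under eq_bigr => o _ do rewrite wE'.
  under [RHS]eq_bigr => o _ do rewrite wE (wt_right _ true) big_bool.
  rewrite !sum_bool2 /= !set_line_idem !nthl.
  rewrite !(setE _ true false) /line_prob /vertex_prob /left_boundary
    /right_boundary /= (gtn_eqF N0) !add0n eqxx.
  ring.
have lt_kN : (k < N)%N by lia.
have [dl dl'] := dirl kpos; have [dr dr'] := dirr lt_kN.
under [RHS]eq_bigr => o _.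
  rewrite word_raise_set_line // (gtn_eqF kpos) (ltn_eqF lt_kN) dl' dr' /=.
  rewrite (@wt_bulk k) ?kpos // mulr_suml. over.
rewrite exchange_big /=; apply: eq_bigr => ls _.
rewrite mulr_sumr; apply: eq_bigr => o _.
rewrite set_line_idem word_set_line // (gtn_eqF kpos) (ltn_eqF lt_kN) dl dr /=.
rewrite !nth_set_line //; last exact: leq_ltn_trans (leq_pred k) lt_kN.
rewrite prednK // !eqxx (gtn_eqF (ltnSn k)); ring.
Qed.

Lemma wt_run h ks (F : config -> K) : admissible N h ks ->
  \sum_(tau : config) wt (word h tau) * run ks F tau
  = \sum_(tau : config) wt (word (foldl raise h ks) tau) * F tau.
Proof.
elim: ks h => [//|k ks IHks] h /= /andP[hk adm].
by rewrite (wt_step (run ks F) hk) IHks.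
Qed.

End Invariance.

(** * The stationary measure *)

Section Ansatz.
Variables (K : numFieldType) (N : nat) (a b c d th1 th2 : K) (dim : option nat).
Variables (D E : dir -> gmx K dim Full Full).
Variables (W : gmx K dim One Full) (V : gmx K dim Full One).
Hypothesis N0 : (0 < N)%N.
Hypothesis hdef : products_well_defined D E W V.
Hypothesis hassoc : products_associative D E W V.
Notation wt := (weight D E W V).
Notation mx := (arrow_mx D E).
Notation prob := (line_prob N a b c d th1 th2).

Hypotheses (hDD : forall i j, (D Up ** D Right) i j = (D Right ** D Up) i j)
  (hEE : forall i j, (E Up ** E Right) i j = (E Right ** E Up) i j)
  (hDE : forall i j, (D Up ** E Right) i j
     = (1 - th2) * (D Right ** E Up) i j + th1 * (E Right ** D Up) i j)
  (hED : forall i j, (E Up ** D Right) i j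
     = th2 * (D Right ** E Up) i j + (1 - th1) * (E Right ** D Up) i j)
  (hWD : forall i j, (W ** D Right) i j
     = (1 - c) * (W ** D Up) i j + a * (W ** E Up) i j)
  (hWE : forall i j, (W ** E Right) i j
     = (1 - a) * (W ** E Up) i j + c * (W ** D Up) i j)
  (hDV : forall i j, (D Up ** V) i j
     = (1 - b) * (D Right ** V) i j + d * (E Right ** V) i j)
  (hEV : forall i j, (E Up ** V) i j
     = (1 - d) * (E Right ** V) i j + b * (D Right ** V) i j).

(** The commutation relations are the cases of two or no incoming arrows, the
    quadratic relations those of one arrow. *)
Lemma mx_bulk k t r : (0 < k < N)%N ->
  mx (t, Up) ** mx (r, Right) = fun i j =>
    \sum_o prob k o.1 o.2 t r * (mx (o.1, Right) ** mx (o.2, Up)) i j.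
Proof.
case/andP=> k0 kN; apply/funext => i; apply/funext => j; rewrite sum_bool2.
rewrite /line_prob /vertex_prob /left_boundary /right_boundary /= add0n.
rewrite (gtn_eqF k0) (ltn_eqF kN) /arrow_mx /=.
case: t r => [] [] /=; first [rewrite hDD | rewrite hEE | rewrite hDE | rewrite hED];
  ring.
Qed.

Lemma mx_left l r :
  W ** mx (r, Right) = fun i j =>
    \sum_s prob 0 l s false r * (W ** mx (s, Up)) i j.
Proof.
apply/funext => i; apply/funext => j; rewrite big_bool.
by case: r; rewrite /arrow_mx /= ?hWD ?hWE // addrC.
Qed.

Lemma mx_right s t :
  mx (t, Up) ** V = fun i j =>
    \sum_l prob N l s t false * (mx (l, Right) ** V) i j.
Proof.
apply/funext => i; apply/funext => j; rewrite big_bool.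
rewrite /line_prob /vertex_prob /left_boundary /right_boundary /= add0n.
rewrite (gtn_eqF N0) eqxx /arrow_mx.
by case: t; rewrite /= ?hDV ?hEV // addrC.
Qed.

Lemma weight_run h ks (F : config N -> K) : admissible N h ks ->
  \sum_(tau : config N) wt (word h tau) * run a b c d th1 th2 ks F tau
  = \sum_(tau : config N) wt (word (foldl raise h ks) tau) * F tau.
Proof.
apply: (wt_run N0).
- move=> k u w t r hk.
  exact: (weight_bulk hdef hassoc u w (mx_bulk t r hk)).
- by move=> w l r; apply: (weight_left hdef hassoc w (mx_left l r)).
- by move=> u s t; apply: (weight_right hdef hassoc u (mx_right s t)).
Qed.

Lemma numerator_weight P h (tau : config N) : P = height_path N h -> descending N h ->
  mpa_numerator D E W V (out_dir N P) tau = wt (word h tau).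
Proof.
move=> -> hh; rewrite /mpa_numerator /weight; congr (sandwich _ _ _).
rewrite /word -val_enum_ord -map_comp -map_comp /image_mem; apply: eq_map => i /=.
rewrite /out_dir out_edge_height // -/(dir_at h i) (tnth_nth false) /arrow_mx /=.
apply/funext => x; apply/funext => y.
by case: nth => /=; rewrite ?subrr ?subr0 !(mul0r, mul1r, add0r, addr0).
Qed.

Lemma denominator_weight P h : P = height_path N h -> descending N h ->
  mpa_denominator N D E W V (out_dir N P) = \sum_(tau : config N) wt (word h tau).
Proof.
move=> -> hh; pose ps := [seq dir_at h i | i <- iota 0 N].
have szps : size ps = N by rewrite size_map size_iota.
transitivity (\sum_(t : (size ps).-tuple bool) wt (zip t ps)).
  rewrite -(sandwich_sum hdef) /mpa_denominator; congr (sandwich _ _ _).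
  rewrite /ps -val_enum_ord -map_comp -map_comp /image_mem; apply: eq_map => i /=.
  by rewrite /out_dir out_edge_height // -/(dir_at h i).
have zE (t : config N) : zip t ps = word h t.
  rewrite /word -[in LHS](mkseq_nth false t) size_tuple /mkseq /ps.
  by rewrite zip_map.
move: (size ps) szps => n en; subst n.
by apply: eq_bigr => t _; rewrite zE.
Qed.

End Ansatz.

Section ParticleSystem.
Variables (K : numFieldType) (N : nat) (a b c d th1 th2 : K).
Variables (P : seq vertex) (h : nat -> nat) (ks : seq nat).
Hypothesis N0 : (0 < N)%N.
Hypothesis hP : P = height_path N h.
Hypothesis hh : descending N h.
Hypothesis hks : vertices_between N P (shift 1 P)
  = [seq ((h k).+1 + k, (h k).+1)%N | k <- ks].
Hypothesis ks_pw : pairwise (line_before h) ks.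
Hypothesis ks_mem : forall j, (j <= N)%N = (j \in ks).

(** The sampling procedure from P to its translate raises every line once. *)
Lemma lines_admissible : [/\ admissible N h ks,
  raised_vertices h ks = vertices_between N P (shift 1 P)
  & forall j, (j <= N)%N -> foldl raise h ks j = (h j).+1].
Proof.
have := @line_before_admissible N h ks [::] hh ks_pw.
have -> : (fun j : nat => h j + (j \in [::]))%N = h.
  by apply/funext => j; rewrite in_nil addn0.
by rewrite hks; apply.
Qed.

Lemma particle_system_run tau tau' :
  particle_system a b c d th1 th2 P tau tau'
  = run a b c d th1 th2 ks (fun x : config N => (x == tau')%:R) tau.
Proof.
have [adm vsE fin] := lines_admissible.
have readK : read N h (arrows_of_config P tau) = tau.
  apply: eq_config => i lti; rewrite nth_read // /arrows_of_config hP.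
  by rewrite index_edge_at.
rewrite -[in RHS]readK -sample_expect_run // vsE /particle_system /transition.
congr (sample_expect _ _ _ _ _ _ _ _ _ _); apply/funext => s.
congr ((_ == _)%:R); apply: eq_from_tnth => i; rewrite !tnth_mktuple.
rewrite hP shift_height out_edge_height //; last first.
  by move=> k /hh [->|->]; [left|right].
have lti := ltn_ord i; rewrite /edge_at !fin //; exact: ltnW.
Qed.

(** Raising every line translates the path, which keeps all directions. *)
Lemma word_final (tau : config N) : word (foldl raise h ks) tau = word h tau.
Proof.
have [_ _ fin] := lines_admissible.
apply/eq_in_map => i; rewrite mem_iota add0n => lti; congr pair.
by rewrite !dir_atE !fin ?eqSS // ltnW.
Qed.

End ParticleSystem.

Theorem theorem2p8 (K : numFieldType) (N : nat) (a b c d th1 th2 : K)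
  (dim : option nat) (D E : dir -> gmx K dim Full Full)
  (W : gmx K dim One Full) (V : gmx K dim Full One) (P : seq vertex)
  (hN : (1 <= N)%N)
  (ha : 0 < a < 1) (hb : 0 < b < 1) (hc : 0 < c < 1) (hd : 0 < d < 1)
  (hth1 : 0 < th1 < 1) (hth2 : 0 < th2 < 1)
  (hdef : products_well_defined D E W V)
  (hassoc : products_associative D E W V)
  (hDD : forall i j, (D Up ** D Right) i j = (D Right ** D Up) i j)
  (hEE : forall i j, (E Up ** E Right) i j = (E Right ** E Up) i j)
  (hDE : forall i j, (D Up ** E Right) i j
     = (1 - th2) * (D Right ** E Up) i j + th1 * (E Right ** D Up) i j)
  (hED : forall i j, (E Up ** D Right) i j
     = th2 * (D Right ** E Up) i j + (1 - th1) * (E Right ** D Up) i j)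
  (hWD : forall i j, (W ** D Right) i j
     = (1 - c) * (W ** D Up) i j + a * (W ** E Up) i j)
  (hWE : forall i j, (W ** E Right) i j
     = (1 - a) * (W ** E Up) i j + c * (W ** D Up) i j)
  (hDV : forall i j, (D Up ** V) i j
     = (1 - b) * (D Right ** V) i j + d * (E Right ** V) i j)
  (hEV : forall i j, (E Up ** V) i j
     = (1 - d) * (E Right ** V) i j + b * (D Right ** V) i j)
  (hP : down_right_path N P)
  (hden : mpa_denominator N D E W V (out_dir N P) != 0) :
  let T : config N -> config N -> K := particle_system a b c d th1 th2 P in
  let mu (tau : config N) : K := mpa_numerator D E W V (out_dir N P) tau
                                 / mpa_denominator N D E W V (out_dir N P) in
  stationary_measure T mu
  /\ forall nu : config N -> K, stationary_measure T nu ->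
     forall tau : config N, nu tau = mu tau.
Proof.
have [h hPh hh] := down_right_heights hP.
have [ks [vsE ks_pw ks_mem]] := vertices_between_lines hh.
rewrite -shift_height -hPh in vsE.
have [adm _ _] := lines_admissible hh vsE ks_pw ks_mem.
have TE := particle_system_run a b c d th1 th2 hN hPh hh vsE ks_pw ks_mem.
have ks_le : {in ks, forall k, (k <= N)%N} by move=> k; rewrite ks_mem.
move=> T mu; rewrite /T.
apply: (@invariant_vector_stationary _ _ _ (empty_config N) (@potential N)).
- split=> [x y|x]; first by rewrite TE run_ge0 // => t; exact: ler0n.
  by under eq_bigr do rewrite TE; apply: run_sum.
- move=> tau; exists (push_lines ks tau).
    by rewrite TE run_push_gt0.
  have [lt_pot|[-> fixed]] := push_lines_potential tau ks_le; [by left | right].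
  suff -> : tau = empty_config N by [].
  by apply: push_line_fixed => k; rewrite ks_mem; apply: fixed.
- move=> y; rewrite /mu.
  have muT := weight_run hN hdef hassoc hDD hEE hDE hED hWD hWE hDV hEV
    (fun x : config N => (x == y)%:R) adm.
  under eq_bigr => x _ do
    rewrite TE (numerator_weight D E W V x hPh hh) mulrAC.
  rewrite -mulr_suml muT; congr (_ / _).
  rewrite (bigD1 y) //= eqxx mulr1 big1 ?addr0 => [|x /negPf ->]; last first.
    by rewrite mulr0.
  by rewrite (word_final hh vsE ks_pw ks_mem) (numerator_weight D E W V y hPh hh).
- rewrite /mu -mulr_suml -(divff hden); congr (_ / _).
  rewrite (denominator_weight hdef hPh hh); apply: eq_bigr => x _.
  exact: numerator_weight.
Qed.
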